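(* Let $\kappa\in\mathbb K$. For every $x\in\bar{\mathfrak g}$ and every integer $r\ge1$, the following holds in the vertex algebra $V^\kappa(\mathfrak g)$: $$Y\big(\iota(x_{-r})|0\rangle,z\big)=Y\big((x_{-r}^p-(x^{[p]})_{-rp})|0\rangle,z\big)={:}\big(\partial^{(r-1)}x(z)\big)^p{:}-\partial^{(rp-1)}x^{[p]}(z)=\iota\big(\partial^{(r-1)}x(z)\big),$$ where $\iota\big(\partial^{(r-1)}x(z)\big):=\sum_{n\in\mathbb Z}\binom{-n-1}{r-1}\,\iota(x_n)\,z^{-np-rp}$.
   Context: $\mathbb K$ is an algebraically closed field of characteristic $p>0$. $\bar{\mathfrak g}$ is a finite-dimensional semisimple Lie algebra over $\mathbb K$, the Lie algebra of a simply connected algebraic group, with $p$-power map $x\mapsto x^{[p]}$ and non-degenerate invariant form $\langle\cdot,\cdot\rangle$. The affine algebra is $\mathfrak g=\mathbb K[t,t^{-1}]\otimes\bar{\mathfrak g}\oplus\mathbb Kc$ with $c$ central, $x_n=t^n\otimes x$, $[x_m,y_n]=[x,y]_{m+n}+m\langle x,y\rangle\delta_{m,-n}c$. Put $x(z)=\sum_{n\in\mathbb Z}x_nz^{-n-1}$, $\partial^{(i)}=\partial_z^i/i!$ (divided power of the derivative), so $\partial^{(r-1)}x(z)=\sum_n\binom{-n-1}{r-1}x_nz^{-n-r}$. $V^\kappa(\mathfrak g)=U(\mathfrak g)\otimes_{U(\mathbb K[t]\otimes\bar{\mathfrak g}+\mathbb Kc)}\mathbb K_\kappa$ is the vacuum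 module of level $\kappa$ ($\mathbb K[t]\otimes\bar{\mathfrak g}$ acts on $\mathbb K_\kappa=\mathbb K$ by $0$, $c$ by $\kappa$), a vertex algebra with vacuum $|0\rangle=1\otimes1$ and state-field correspondence $Y(x_{-r_1}y_{-r_2}\cdots|0\rangle,z)={:}\partial^{(r_1-1)}x(z)\,\partial^{(r_2-1)}y(z)\cdots{:}$. For $x\in\bar{\mathfrak g}$, $n\in\mathbb Z$, $\iota(x_n)=x_n^p-(x^{[p]})_{np}\in U(\mathfrak g)$, and $\iota(z)=z^p$; $\iota$ is applied to the field $\partial^{(r-1)}x(z)$ by applying it to the modes $x_n$ and to $z$. *)

(* Defs.v *)
From HB Require Import structures.
From mathcomp Require Import all_boot all_order all_algebra.
From mathcomp Require Import mathcomp_extra boolp classical_sets functions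
  cardinality fsbigop.
From mathcomp Require Import generic_quotient.
From mathcomp Require mpoly.

Set Implicit Arguments.
Unset Strict Implicit.
Unset Printing Implicit Defensive.

Import Order.TTheory GRing.Theory Num.Theory.
Local Open Scope classical_set_scope.
Local Open Scope ring_scope.

HB.mixin Record Lmodule_isLie (K : fieldType) L of GRing.Lmodule K L := {
  lie : L -> L -> L;
  lie_linearl : forall y, linear (lie^~ y);
  lie_linearr : forall x, linear (lie x);
  liexx : forall x, lie x x = 0;
  lie_jacobi : forall x y z,
    lie x (lie y z) + lie y (lie z x) + lie z (lie x y) = 0
}.

#[short(type="lieType")]
HB.structure Definition Lie (K : fieldType) :=
  {L of GRing.Lmodule K L & Lmodule_isLie K L}.

#[short(type="finDimLieType")]
HB.structure Definition FinDimLie (K : fieldType) :=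
  {L of Vector K L & Lmodule_isLie K L}.

Section LieTheory.
Variables (K : fieldType) (L : lieType K).
Implicit Types x y : L.

Lemma lieDl y : {morph lie^~ y : x x' / x + x' >-> (x + x' : L)}.
Proof. by move=> a b; have := @lie_linearl K L y 1 a b; rewrite !scale1r. Qed.
Lemma lieDr x : {morph lie x : y y' / y + y' >-> (y + y' : L)}.
Proof. by move=> a b; have := @lie_linearr K L x 1 a b; rewrite !scale1r. Qed.
Lemma lie0x y : lie (0 : L) y = 0.
Proof. by apply: (addrI (lie 0 y)); rewrite -lieDl !addr0. Qed.
Lemma liex0 x : lie x (0 : L) = 0.
Proof. by apply: (addrI (lie x 0)); rewrite -lieDr !addr0. Qed.
Lemma lieZl a x y : lie (a *: x) y = a *: lie x y.
Proof. by have := @lie_linearl K L y a x 0; rewrite lie0x !addr0. Qed.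
Lemma lieZr a x y : lie x (a *: y) = a *: lie x y.
Proof. by have := @lie_linearr K L x a y 0; rewrite liex0 !addr0. Qed.
Lemma lieC x y : lie x y = - lie y x.
Proof.
apply/eqP; rewrite -addr_eq0; apply/eqP.
by have := @liexx K L (x + y); rewrite lieDl !lieDr !liexx add0r addr0.
Qed.
End LieTheory.

Section SemisimpleLie.
Variables (K : fieldType) (L : finDimLieType K).
Implicit Types U W : {vspace L}.

Definition lie_span U W : {vspace L} :=
  <<[seq lie u w | u <- vbasis U, w <- vbasis W]>>%VS.

Definition lie_ideal U := forall x u : L, u \in U -> lie x u \in U.

Definition lie_solvable U :=
  exists k, iter k (fun W => lie_span W W) U = 0%VS.

Definition semisimple_lie :=
  forall U, lie_ideal U -> lie_solvable U -> U = 0%VS.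
End SemisimpleLie.

Record invForm (K : fieldType) (L : lieType K) := InvForm {
  form :> L -> L -> K;
  form_linear : forall y, linear (form^~ y : L -> K^o);
  form_sym : forall x y, form x y = form y x;
  form_inv : forall x y z, form (lie x y) z = form x (lie y z)
}.

Definition nondegenerate_form (K : fieldType) (L : lieType K) (B : invForm L) :=
  forall x, (forall y, B x y = 0) -> x = 0.

(* Linear algebraic groups over an algebraically closed field, as Zariski     *)
(* closed subgroups of GL_n; a matrix is a point of affine space via mxvec.   *)
Section AlgebraicGroups.
Variable K : closedFieldType.

Definition mx_eval n (f : mpoly.mpoly (n * n) K) (A : 'M[K]_n) : K :=
  mpoly.meval (fun i => mxvec A 0 i) f.

Definition zariski_closed n (C : set 'M[K]_n) :=
  exists S : set (mpoly.mpoly (n * n) K),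
    forall A, C A <-> (A \in unitmx /\ forall f, S f -> mx_eval f A = 0).

Definition mx_subgroup n (G : set 'M[K]_n) :=
  [/\ forall A, G A -> A \in unitmx,
      G 1%:M,
      forall A A', G A -> G A' -> G (A *m A') &
      forall A, G A -> G (invmx A)].

Definition algebraic_group n (G : set 'M[K]_n) :=
  zariski_closed G /\ mx_subgroup G.

Definition zariski_connected n (G : set 'M[K]_n) :=
  forall C D, zariski_closed C -> zariski_closed D ->
    G `<=` C `|` D -> G `&` C `&` D = set0 -> G `<=` C \/ G `<=` D.

Inductive commutator_subgroup n (G : set 'M[K]_n) : set 'M[K]_n :=
| commutator_one : commutator_subgroup G 1%:M
| commutator_comm A A' : G A -> G A' ->
    commutator_subgroup G (A *m A' *m invmx A *m invmx A')
| commutator_mul A A' : commutator_subgroup G A -> commutator_subgroup G A' ->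
    commutator_subgroup G (A *m A')
| commutator_inv A : commutator_subgroup G A ->
    commutator_subgroup G (invmx A).

Definition mx_solvable n (G : set 'M[K]_n) :=
  exists k, iter k (@commutator_subgroup n) G = [set 1%:M].

Definition mx_normal n (N G : set 'M[K]_n) :=
  N `<=` G /\ forall A A', G A -> N A' -> N (A *m A' *m invmx A).

Definition semisimple_group n (G : set 'M[K]_n) :=
  [/\ algebraic_group G, zariski_connected G &
      forall N, algebraic_group N -> zariski_connected N ->
        mx_normal N G -> mx_solvable N -> N = [set 1%:M]].

Definition regular n (G : set 'M[K]_n) (f : 'M[K]_n -> K) :=
  exists (P : mpoly.mpoly (n * n) K) (k : nat),
    forall A, G A -> f A = mx_eval P A / \det A ^+ k.

Definition regular2 n (G : set 'M[K]_n) (f : 'M[K]_n -> 'M[K]_n -> K) :=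
  exists (P : mpoly.mpoly (n * n + n * n) K) (k : nat),
    forall A A', G A -> G A' ->
      f A A' = mpoly.meval (fun i => row_mx (mxvec A) (mxvec A') 0 i) P
               / (\det A * \det A') ^+ k.

Definition group_morphism m n (H : set 'M[K]_m) (G : set 'M[K]_n)
    (phi : 'M[K]_m -> 'M[K]_n) :=
  [/\ forall A, H A -> G (phi A),
      forall A A', H A -> H A' -> phi (A *m A') = phi A *m phi A' &
      forall i j, regular H (fun A => phi A i j)].

(* An isogeny H -> G is central in the sense of Borel and Tits when the       *)
(* commutator map of H factors through a morphism of varieties G x G -> H;    *)
(* this says that the scheme-theoretic kernel is central.                     *)
Definition central_isogeny m n (H : set 'M[K]_m) (G : set 'M[K]_n)
    (phi : 'M[K]_m -> 'M[K]_n) :=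
  [/\ group_morphism H G phi,
      phi @` H = G,
      finite_set (H `&` [set A | phi A = 1%:M]) &
      exists kappa : 'M[K]_n -> 'M[K]_n -> 'M[K]_m,
        (forall A A', H A -> H A' ->
           kappa (phi A) (phi A') = A *m A' *m invmx A *m invmx A') /\
        (forall i j, regular2 G (fun A A' => kappa A A' i j))].

Definition group_isomorphism m n (H : set 'M[K]_m) (G : set 'M[K]_n)
    (phi : 'M[K]_m -> 'M[K]_n) :=
  group_morphism H G phi /\
  exists psi, [/\ group_morphism G H psi,
    forall A, H A -> psi (phi A) = A & forall A, G A -> phi (psi A) = A].

Definition simply_connected n (G : set 'M[K]_n) :=
  semisimple_group G /\
  forall m (H : set 'M[K]_m) phi,
    algebraic_group H -> zariski_connected H -> central_isogeny H G phi ->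
    group_isomorphism H G phi.

Definition group_lie n (G : set 'M[K]_n) : set 'M[K]_n :=
  [set X | forall f : mpoly.mpoly (n * n) K,
     (forall A, G A -> mx_eval f A = 0) ->
     \sum_i mx_eval (mpoly.mderiv i f) 1%:M * mxvec X 0 i = 0].

(* On the Lie algebra of a closed subgroup of GL_n the bracket is the matrix  *)
(* commutator and the p-power map is the matrix p-th power.                   *)
Definition lie_of_simply_connected (p : nat) (L : lieType K)
    (pmap : L -> L) :=
  exists (n : nat) (G : set 'M[K]_n) (rho : {linear L -> 'M[K]_n}),
    [/\ simply_connected G,
        injective rho /\ range rho = group_lie G,
        forall x y, rho (lie x y) = rho x *m rho y - rho y *m rho x &
        forall x, rho (pmap x) = rho x ^+ p].
End AlgebraicGroups.

Section Loop.
Variables (K : fieldType) (L : lieType K).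

Definition fin_loop : {pred int -> L} :=
  fun f => `[< finite_set [set n | f n != 0] >].

Fact fin_loop_submod : submod_closed fin_loop.
Proof.
split=> [|a f h /asboolP finf /asboolP finh].
  by apply/asboolP; apply: (@sub_finite_set _ _ set0) => // n /=; rewrite eqxx.
apply/asboolP; apply: (@sub_finite_set _ _
  ([set n | f n != 0] `|` [set n | h n != 0])); last by rewrite finite_setU.
move=> n /=; case: (eqVneq (f n) 0) => [fn|? _]; last by left.
case: (eqVneq (h n) 0) => [hn|? _]; last by right.
rewrite /GRing.add /= /GRing.scale /=.
by rewrite fn hn scaler0 add0r eqxx.
Qed.
HB.instance Definition _ :=
  GRing.isSubmodClosed.Build K (int -> L) fin_loop fin_loop_submod.

(* K[t, t^-1] (x) L: finitely supported families, n |-> coefficient of t^n    *)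
Record loop := Loop { loop_fun :> int -> L; _ : loop_fun \in fin_loop }.

HB.instance Definition _ := [isSub for loop_fun].
HB.instance Definition _ := [Choice of loop by <:].
HB.instance Definition _ := [SubChoice_isSubLmodule of loop by <:].


Lemma loopP (f h : loop) : (forall n, f n = h n) -> f = h.
Proof. by move=> fh; apply: val_inj; apply/funext. Qed.

Lemma loop0E n : (0 : loop) n = 0. Proof. by []. Qed.
Lemma loopDE (f h : loop) n : (f + h) n = f n + h n. Proof. by []. Qed.
Lemma loopZE a (f : loop) n : (a *: f) n = a *: f n. Proof. by []. Qed.

Lemma loop_finite (f : loop) : finite_set [set n | f n != 0].
Proof. by case: f => f /= /asboolP. Qed.

Lemma loop_suppP (f : loop) :
  exists2 s : seq int, uniq s & forall n, n \notin s -> f n = 0.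
Proof.
have /finite_seqP[s /seteqP[fs _]] := loop_finite f.
exists (undup s); first exact: undup_uniq.
move=> n; rewrite mem_undup; apply: contraNeq => fn.
exact: (fs n fn).
Qed.

Definition monom (n : int) (x : L) : int -> L :=
  fun m => if m == n then x else 0.

Fact monom_fin n x : monom n x \in fin_loop.
Proof.
apply/asboolP; apply: (@sub_finite_set _ _ [set n]) => // m /=.
by rewrite /monom; case: (m =P n) => //; rewrite eqxx.
Qed.

(* t^n (x) x *)
Definition loop_monom n x := Loop (monom_fin n x).

Lemma loop_monomE n x m : loop_monom n x m = if m == n then x else 0.
Proof. by []. Qed.

Lemma loop_decomp (f : loop) (s : seq int) : uniq s ->
  (forall n, n \notin s -> f n = 0) -> f = \sum_(i <- s) loop_monom i (f i).
Proof.
move=> us fs; apply: loopP => n.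
have -> : (\sum_(i <- s) loop_monom i (f i)) n
          = \sum_(i <- s) loop_monom i (f i) n.
  by apply: (big_morph (fun h : loop => h n)).
case: (boolP (n \in s)) => ns.
  rewrite (bigD1_seq n)// loop_monomE eqxx big1 ?Monoid.mulm1// => i ni.
  by rewrite loop_monomE eq_sym (negbTE ni).
rewrite fs// big_seq big1// => i si; rewrite loop_monomE.
by case: eqP => // nei; rewrite nei si in ns.
Qed.

Definition loop_bracket (f h : loop) : int -> L :=
  fun n => \sum_(i \in [set: int]) lie (f i) (h (n - i)).

Fact loop_bracket_fin f h : loop_bracket f h \in fin_loop.
Proof.
apply/asboolP; apply: (@sub_finite_set _ _
    [set i + j | i in [set n | f n != 0] & j in [set n | h n != 0]]).
  move=> n /= /eqP nz; apply: contrapT => nex; apply: nz.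
  apply: fsbig1 => i _; case: (eqVneq (f i) 0) => [->|fi]; first exact: lie0x.
  case: (eqVneq (h (n - i)) 0) => [->|hi]; first exact: liex0.
  by exfalso; apply: nex; exists i => //; exists (n - i) => //; rewrite subrKC.
by apply: finite_image2; exact: loop_finite.
Qed.

Definition loop_lie f h := Loop (loop_bracket_fin f h).

Lemma loop_lieE (s : seq int) (f h : loop) n : uniq s ->
  (forall n, n \notin s -> f n = 0) ->
  loop_lie f h n = \sum_(i <- s) lie (f i) (h (n - i)).
Proof.
move=> us fs; rewrite /= /loop_bracket (fsbigE s)//.
- by apply: eq_bigl => i; rewrite in_setT.
- by move=> i _ /fs->; rewrite lie0x.
Qed.

Definition loop_cocycle (B : invForm L) (f h : loop) : K :=
  \sum_(i \in [set: int]) (i%:~R * B (f i) (h (- i))).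

Lemma form0x (B : invForm L) x : B 0 x = 0.
Proof.
have := form_linear B x 1 0 0; rewrite !scale1r addr0 => e.
by apply: (addrI (B 0 x)); rewrite addr0.
Qed.

Lemma loop_cocycleE (s : seq int) B (f h : loop) : uniq s ->
  (forall n, n \notin s -> f n = 0) ->
  loop_cocycle B f h = \sum_(i <- s) (i%:~R * B (f i) (h (- i))).
Proof.
move=> us fs; rewrite /= /loop_cocycle (fsbigE s)//.
- by apply: eq_bigl => i; rewrite in_setT.
- by move=> i _ /fs->; rewrite form0x mulr0.
Qed.

End Loop.

(* The pair (f, a) stands for f + a c. *)
Definition affine (K : fieldType) (L : lieType K) (B : invForm L) : Type :=
  (loop L * K^o)%type.

Section Affine.
Variables (K : fieldType) (L : lieType K) (B : invForm L).

Lemma formDl y : {morph (fun x => B x y) : x x' / x + x'}.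
Proof. by move=> x x'; have := form_linear B y 1 x x'; rewrite !scale1r. Qed.
Lemma formZl a x y : B (a *: x) y = a * B x y.
Proof. by have := form_linear B y a x 0; rewrite form0x !addr0. Qed.

Lemma loop_supp2P (f f' : loop L) : exists s : seq int,
  [/\ uniq s, forall n, n \notin s -> f n = 0
            & forall n, n \notin s -> f' n = 0].
Proof.
have [s us fs] := loop_suppP f; have [s' us' fs'] := loop_suppP f'.
exists (undup (s ++ s')); rewrite undup_uniq; split=> // n;
  rewrite mem_undup mem_cat negb_or => /andP[ns ns'].
  exact: fs.
exact: fs'.
Qed.

Lemma loop_lie_linearl h : linear ((@loop_lie K L)^~ h).
Proof.
move=> a f f'; apply: loopP => n.
have [s [us fs fs']] := loop_supp2P f f'.
rewrite loopDE loopZE !(loop_lieE _ _ us)//; last first.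
  by move=> m ms; rewrite loopDE loopZE fs// fs'// scaler0 addr0.
rewrite scaler_sumr -big_split; apply: eq_bigr => i _.
by rewrite loopDE loopZE lieDl lieZl.
Qed.

Lemma loop_lie_linearr f : linear (@loop_lie K L f).
Proof.
move=> a h h'; apply: loopP => n.
have [s us fs] := loop_suppP f.
rewrite loopDE loopZE !(loop_lieE _ _ us)//.
rewrite scaler_sumr -big_split; apply: eq_bigr => i _.
by rewrite loopDE loopZE lieDr lieZr.
Qed.

Lemma loop_cocycle_linearl h :
  linear ((@loop_cocycle K L B)^~ h : loop L -> K^o).
Proof.
move=> a f f'; have [s [us fs fs']] := loop_supp2P f f'.
rewrite !(loop_cocycleE _ _ us)//; last first.
  by move=> m ms; rewrite loopDE loopZE fs// fs'// scaler0 addr0.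
rewrite scaler_sumr -big_split; apply: eq_bigr => i _.
rewrite loopDE loopZE formDl formZl mulrDr; congr (_ + _).
by rewrite mulrCA.
Qed.

Lemma loop_cocycle_linearr f : linear (@loop_cocycle K L B f : loop L -> K^o).
Proof.
move=> a h h'; have [s us fs] := loop_suppP f.
rewrite !(loop_cocycleE _ _ us)//.
rewrite scaler_sumr -big_split; apply: eq_bigr => i _.
rewrite loopDE loopZE !(form_sym B (f i)) formDl formZl mulrDr; congr (_ + _).
by rewrite mulrCA.
Qed.

Lemma loop_lie_monom m n x y :
  loop_lie (@loop_monom K L m x) (loop_monom n y)
  = loop_monom (m + n) (lie x y).
Proof.
apply: loopP => k; rewrite (@loop_lieE K L [:: m])//; last first.
  by move=> i; rewrite inE loop_monomE => /negbTE->.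
rewrite big_seq1 !loop_monomE eqxx subr_eq (addrC n).
by case: eqP => // _; rewrite liex0.
Qed.

Lemma loop_cocycle_monom m n x y :
  loop_cocycle B (loop_monom m x) (loop_monom n y)
  = if m == - n then m%:~R * B x y else 0.
Proof.
rewrite (@loop_cocycleE K L [:: m])//; last first.
  by move=> i; rewrite inE loop_monomE => /negbTE->.
rewrite big_seq1 !loop_monomE eqxx eqr_oppLR.
by case: eqP => // _; rewrite form_sym form0x mulr0.
Qed.

HB.instance Definition _ := GRing.Lmodule.on (affine B).

Definition affine_lie (X Z : affine B) : affine B :=
  (loop_lie X.1 Z.1, loop_cocycle B X.1 Z.1).

Fact affine_lie_linearl Z : linear (affine_lie^~ Z).
Proof.
move=> a X X'; rewrite /affine_lie; congr pair.
  exact: loop_lie_linearl.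
exact: loop_cocycle_linearl.
Qed.

Fact affine_lie_linearr X : linear (affine_lie X).
Proof.
move=> a Z Z'; rewrite /affine_lie; congr pair.
  exact: loop_lie_linearr.
exact: loop_cocycle_linearr.
Qed.

Let affmon (n : int) (x : L) : affine B := (loop_monom n x, 0).
Let affc (a : K) : affine B := (0, a).

Let affine_decomp (X : affine B) : exists s : seq (affine B),
  (forall Z, Z \in s -> exists n x, Z = affmon n x)
  /\ X = affc X.2 + \sum_(Z <- s) Z.
Proof.
case: X => f a; have [s us fs] := loop_suppP f.
exists [seq affmon i (f i) | i <- s]; split.
  by move=> Z /mapP[i _ ->]; exists i, (f i).
rewrite big_map; have -> : \sum_(i <- s) affmon i (f i) = (f, 0) :> affine B.
  rewrite [in RHS](loop_decomp us fs); elim: (s) => [|i t IH].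
    by rewrite !big_nil.
  by rewrite !big_cons IH /affmon; congr pair; rewrite addr0.
by congr pair; rewrite ?add0r ?addr0.
Qed.

Let alieDl Z : {morph affine_lie^~ Z : X X' / X + X'}.
Proof.
by move=> X X'; have := affine_lie_linearl Z 1 X X'; rewrite !scale1r.
Qed.
Let alieDr X : {morph affine_lie X : Z Z' / Z + Z'}.
Proof.
by move=> Z Z'; have := affine_lie_linearr X 1 Z Z'; rewrite !scale1r.
Qed.
Let alie0x Z : affine_lie 0 Z = 0.
Proof. by apply: (addrI (affine_lie 0 Z)); rewrite -alieDl !addr0. Qed.
Let aliex0 X : affine_lie X 0 = 0.
Proof. by apply: (addrI (affine_lie X 0)); rewrite -alieDr !addr0. Qed.

Let alie_cx a Z : affine_lie (affc a) Z = 0.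
Proof. by have := alie0x Z; rewrite /affine_lie. Qed.
Let alie_xc a X : affine_lie X (affc a) = 0.
Proof. by have := aliex0 X; rewrite /affine_lie. Qed.

Let alie_mon m n x y : affine_lie (affmon m x) (affmon n y)
  = affmon (m + n) (lie x y) + affc (if m == - n then m%:~R * B x y else 0).
Proof.
rewrite /affine_lie /= loop_lie_monom loop_cocycle_monom.
by congr pair; rewrite ?add0r ?addr0.
Qed.

Let loop_monom_add n x y :
  @loop_monom K L n x + loop_monom n y = loop_monom n (x + y).
Proof.
by apply: loopP => k; rewrite loopDE !loop_monomE; case: eqP; rewrite ?addr0.
Qed.

Let loop_monom0 n : @loop_monom K L n 0 = 0.
Proof. by apply: loopP => k; rewrite loop_monomE; case: eqP. Qed.

Let alie_monC m n x y :
  affine_lie (affmon m x) (affmon n y)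
  + affine_lie (affmon n y) (affmon m x) = 0.
Proof.
rewrite !alie_mon addrACA (addrC n); congr pair.
  by rewrite /= !addr0 loop_monom_add (lieC y) subrr loop_monom0.
have -> : (n == - m) = (m == - n) by rewrite eq_sym eqr_oppLR.
rewrite /= !add0r (form_sym B y).
case: eqP => [->|_]; last by rewrite addr0.
by rewrite -mulrDl -rmorphD/= addNr rmorph0 mul0r.
Qed.

Let alie_monxx n x : affine_lie (affmon n x) (affmon n x) = 0.
Proof.
rewrite alie_mon liexx /affmon loop_monom0; congr pair; first by rewrite addr0.
rewrite /= add0r; case: eqP => // n0.
suff -> : n = 0 by rewrite mul0r.
by apply/eqP; rewrite -eqNr -n0.
Qed.

Fact affine_liexx X : affine_lie X X = 0.
Proof.
have [s [ms ->]] := affine_decomp X; set S := \sum_(Z <- s) Z.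
rewrite alieDl !alieDr !alie_cx alie_xc !add0r {}/S.
elim: s ms => [|Z s IH] ms; first by rewrite big_nil alie0x.
rewrite big_cons alieDl !alieDr IH ?addr0; last first.
  by move=> W Ws; apply: ms; rewrite inE Ws orbT.
have [n [x ->]] := ms Z (mem_head _ _).
rewrite alie_monxx add0r.
elim: s {IH} ms => [|W s IH] ms; first by rewrite big_nil aliex0 alie0x addr0.
rewrite big_cons alieDl alieDr addrACA IH ?addr0; last first.
  move=> U; rewrite inE => /orP[/eqP->|Us]; first exact/ms/mem_head.
  by apply: ms; rewrite !inE Us !orbT.
have [k [y ->]] : exists k y, W = affmon k y by apply: ms; rewrite !inE eqxx orbT.
exact: alie_monC.
Qed.

Let jac X Y Z := affine_lie X (affine_lie Y Z) + affine_lie Y (affine_lie Z X)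
  + affine_lie Z (affine_lie X Y).

Let jacDl Y Z : {morph (fun X => jac X Y Z) : X X' / X + X'}.
Proof.
move=> X X'; rewrite /jac !alieDl !alieDr.
by rewrite (addrACA (affine_lie X _)); exact: addrACA.
Qed.

Let jac_rot X Y Z : jac X Y Z = jac Y Z X.
Proof. by rewrite /jac [RHS]addrC addrA. Qed.

Let jac_c a Y Z : jac (affc a) Y Z = 0.
Proof. by rewrite /jac !alie_cx alie_xc !aliex0 !addr0. Qed.

Let jac_red (Y Z : affine B) : (forall n x, jac (affmon n x) Y Z = 0) ->
  forall X, jac X Y Z = 0.
Proof.
move=> h X; have [s [ms ->]] := affine_decomp X.
rewrite jacDl jac_c add0r; elim: s ms => [|W s IH] ms.
  by rewrite big_nil; apply: (addrI (jac 0 Y Z)); rewrite -jacDl !addr0.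
rewrite big_cons jacDl IH ?addr0; last first.
  by move=> U Us; apply: ms; rewrite inE Us orbT.
by have [n [x ->]] := ms W (mem_head _ _).
Qed.

Fact affine_lie_jacobi X Y Z :
  affine_lie X (affine_lie Y Z) + affine_lie Y (affine_lie Z X)
  + affine_lie Z (affine_lie X Y) = 0.
Proof.
rewrite -/(jac X Y Z); move: X; apply: jac_red => m x.
rewrite jac_rot; move: Y; apply: jac_red => n y.
rewrite jac_rot; move: Z; apply: jac_red => k z.
rewrite /jac !alie_mon !alieDr !alie_xc !addr0 !alie_mon.
set d := m + n + k.
have -> : k + (m + n) = d by rewrite addrC.
have -> : m + (n + k) = d by rewrite addrA.
have -> : n + (k + m) = d by rewrite addrCA addrC -addrA addrCA addrA.
have eqd a b : a + b = d -> (a == - b) = (d == 0) by move=> <-; rewrite addr_eq0.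
rewrite (eqd k (m + n)) ?(eqd m (n + k)) ?(eqd n (k + m)); first last.
- by rewrite addrC.
- by rewrite addrA.
- by rewrite addrCA addrC -addrA addrCA addrA.
have Bz : B z (lie x y) = B x (lie y z) by rewrite form_sym form_inv.
have By : B y (lie z x) = B x (lie y z) by rewrite -form_inv form_sym.
rewrite Bz By addrACA [affmon d _ + _ + _ + _]addrACA.
congr pair => /=.
  rewrite !addr0 !loop_monom_add -addrA addrC.
  by rewrite lie_jacobi loop_monom0.
rewrite !add0r; case: (eqVneq d 0) => [d0|_]; last by rewrite !addr0.
rewrite -!mulrDl -!rmorphD/=.
suff -> : k + m + n = 0 by rewrite rmorph0 mul0r.
by rewrite -addrA addrC.
Qed.

HB.instance Definition _ :=
  Lmodule_isLie.Build K (affine B) affine_lie_linearl affine_lie_linearr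
    affine_liexx affine_lie_jacobi.

End Affine.

(* U(L) by generators and relations: formal expressions over K and L modulo   *)
(* the smallest congruence making them a unital associative K-algebra in      *)
(* which uexp_gen is linear and [x, y] = xy - yx.                             *)
Section Enveloping.
Variables (K : fieldType) (L : lieType K).

Inductive uexp : Type :=
| uexp_gen of L
| uexp_scal of K
| uexp_add of uexp & uexp
| uexp_mul of uexp & uexp.

Inductive urel : uexp -> uexp -> Prop :=
| urel_refl u : urel u u
| urel_sym u v : urel u v -> urel v u
| urel_trans u v w : urel u v -> urel v w -> urel u w
| urel_add u u' v v' : urel u u' -> urel v v' ->
    urel (uexp_add u v) (uexp_add u' v')
| urel_mul u u' v v' : urel u u' -> urel v v' ->
    urel (uexp_mul u v) (uexp_mul u' v')
| urel_addA u v w :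
    urel (uexp_add u (uexp_add v w)) (uexp_add (uexp_add u v) w)
| urel_addC u v : urel (uexp_add u v) (uexp_add v u)
| urel_mulA u v w :
    urel (uexp_mul u (uexp_mul v w)) (uexp_mul (uexp_mul u v) w)
| urel_mulDl u v w : urel (uexp_mul (uexp_add u v) w)
    (uexp_add (uexp_mul u w) (uexp_mul v w))
| urel_mulDr u v w : urel (uexp_mul u (uexp_add v w))
    (uexp_add (uexp_mul u v) (uexp_mul u w))
| urel_add0 u : urel (uexp_add (uexp_scal 0) u) u
| urel_mul0 u : urel (uexp_mul (uexp_scal 0) u) (uexp_scal 0)
| urel_mul1 u : urel (uexp_mul (uexp_scal 1) u) u
| urel_scalD a b :
    urel (uexp_scal (a + b)) (uexp_add (uexp_scal a) (uexp_scal b))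
| urel_scalM a b :
    urel (uexp_scal (a * b)) (uexp_mul (uexp_scal a) (uexp_scal b))
| urel_scalC a u :
    urel (uexp_mul (uexp_scal a) u) (uexp_mul u (uexp_scal a))
| urel_genD x y :
    urel (uexp_gen (x + y)) (uexp_add (uexp_gen x) (uexp_gen y))
| urel_genZ a x :
    urel (uexp_gen (a *: x)) (uexp_mul (uexp_scal a) (uexp_gen x))
| urel_lie x y :
    urel (uexp_mul (uexp_gen x) (uexp_gen y))
         (uexp_add (uexp_mul (uexp_gen y) (uexp_gen x)) (uexp_gen (lie x y))).

HB.instance Definition _ := gen_eqMixin uexp.
HB.instance Definition _ := gen_choiceMixin uexp.

Definition urelb (u v : uexp) : bool := `[< urel u v >].

Fact urelb_refl : reflexive urelb.
Proof. by move=> u; apply/asboolP; exact: urel_refl. Qed.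
Fact urelb_sym : symmetric urelb.
Proof. by move=> u v; apply/asboolP/asboolP; exact: urel_sym. Qed.
Fact urelb_trans : transitive urelb.
Proof.
by move=> v u w /asboolP uv /asboolP vw; apply/asboolP/(urel_trans uv vw).
Qed.
Canonical urelb_equiv := EquivRel urelb urelb_refl urelb_sym urelb_trans.

Definition env : Type := {eq_quot urelb}%qT.
HB.instance Definition _ := Choice.on env.

Definition env_pi (u : uexp) : env := \pi_({eq_quot urelb})%qT u.
Definition env_repr (u : env) : uexp := repr (u : {eq_quot urelb}%qT).

Lemma env_piK : cancel env_repr env_pi.
Proof. by move=> u; rewrite /env_pi /env_repr reprK. Qed.

Lemma env_piP u v : env_pi u = env_pi v <-> urel u v.
Proof.
rewrite /env_pi; split=> [/eqmodP/asboolP//|uv].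
by apply/eqmodP/asboolP.
Qed.

Lemma env_reprK u : urel (env_repr (env_pi u)) u.
Proof. by apply/env_piP; rewrite env_piK. Qed.

Lemma env_ind (P : env -> Prop) : (forall u, P (env_pi u)) -> forall u, P u.
Proof. by move=> h u; rewrite -[u]env_piK. Qed.

Definition env_scal (a : K) : env := env_pi (uexp_scal a).
Definition env_add (u v : env) : env :=
  env_pi (uexp_add (env_repr u) (env_repr v)).
Definition env_mul (u v : env) : env :=
  env_pi (uexp_mul (env_repr u) (env_repr v)).

Lemma env_addE u v : env_add (env_pi u) (env_pi v) = env_pi (uexp_add u v).
Proof. by apply/env_piP/urel_add; exact: env_reprK. Qed.
Lemma env_mulE u v : env_mul (env_pi u) (env_pi v) = env_pi (uexp_mul u v).
Proof. by apply/env_piP/urel_mul; exact: env_reprK. Qed.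

Fact env_addA : associative env_add.
Proof.
elim/env_ind=> u; elim/env_ind=> v; elim/env_ind=> w; rewrite !env_addE.
by apply/env_piP/urel_addA.
Qed.
Fact env_addC : commutative env_add.
Proof.
elim/env_ind=> u; elim/env_ind=> v; rewrite !env_addE.
by apply/env_piP/urel_addC.
Qed.
Fact env_add0 : left_id (env_scal 0) env_add.
Proof.
by elim/env_ind=> u; rewrite !env_addE; apply/env_piP/urel_add0.
Qed.
Fact env_addN : left_inverse (env_scal 0) (env_mul (env_scal (- 1))) env_add.
Proof.
elim/env_ind=> u; rewrite env_mulE env_addE; apply/env_piP.
have u1 : urel u (uexp_mul (uexp_scal 1) u) by apply/urel_sym/urel_mul1.
apply: (urel_trans (urel_add (urel_refl _) u1)).
apply: (urel_trans (urel_sym (urel_mulDl _ _ _))).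
apply: (urel_trans (urel_mul (urel_sym (urel_scalD _ _)) (urel_refl u))).
by rewrite addNr; exact: urel_mul0.
Qed.
HB.instance Definition _ :=
  GRing.isZmodule.Build env env_addA env_addC env_add0 env_addN.

Fact env_mulA : associative env_mul.
Proof.
elim/env_ind=> u; elim/env_ind=> v; elim/env_ind=> w; rewrite !env_mulE.
by apply/env_piP/urel_mulA.
Qed.
Fact env_mul1 : left_id (env_scal 1) env_mul.
Proof. by elim/env_ind=> u; rewrite env_mulE; apply/env_piP/urel_mul1. Qed.
Fact env_mulr1 : right_id (env_scal 1) env_mul.
Proof.
elim/env_ind=> u; rewrite env_mulE; apply/env_piP.
exact: (urel_trans (urel_sym (urel_scalC _ _)) (urel_mul1 _)).
Qed.
Fact env_mulDl : left_distributive env_mul +%R.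
Proof.
elim/env_ind=> u; elim/env_ind=> v; elim/env_ind=> w.
change (env_mul (env_add (env_pi u) (env_pi v)) (env_pi w)
  = env_add (env_mul (env_pi u) (env_pi w)) (env_mul (env_pi v) (env_pi w))).
by rewrite !(env_addE, env_mulE); apply/env_piP/urel_mulDl.
Qed.
Fact env_mulDr : right_distributive env_mul +%R.
Proof.
elim/env_ind=> u; elim/env_ind=> v; elim/env_ind=> w.
change (env_mul (env_pi u) (env_add (env_pi v) (env_pi w))
  = env_add (env_mul (env_pi u) (env_pi v)) (env_mul (env_pi u) (env_pi w))).
by rewrite !(env_addE, env_mulE); apply/env_piP/urel_mulDr.
Qed.

(* The augmentation, which shows that U(L) is not trivial. *)
Fixpoint uexp_aug (u : uexp) : K :=
  match u with
  | uexp_gen _ => 0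
  | uexp_scal a => a
  | uexp_add u v => uexp_aug u + uexp_aug v
  | uexp_mul u v => uexp_aug u * uexp_aug v
  end.

Lemma uexp_aug_urel u v : urel u v -> uexp_aug u = uexp_aug v.
Proof.
elim=> //=.
- by move=> ? ? ? _ -> _ ->.
- by move=> ? ? ? ? _ -> _ ->.
- by move=> ? ? ? ? _ -> _ ->.
- by move=> *; rewrite addrA.
- by move=> *; rewrite addrC.
- by move=> *; rewrite mulrA.
- by move=> *; rewrite mulrDl.
- by move=> *; rewrite mulrDr.
- by move=> *; rewrite add0r.
- by move=> *; rewrite mul0r.
- by move=> *; rewrite mul1r.
- by move=> *; rewrite mulrC.
- by move=> *; rewrite addr0.
- by move=> *; rewrite mulr0.
- by move=> *; rewrite mulr0 addr0.
Qed.

Fact env_1neq0 : env_scal 1 != 0.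
Proof.
by apply/eqP => /env_piP/uexp_aug_urel/eqP; rewrite /= oner_eq0.
Qed.
HB.instance Definition _ := GRing.Zmodule_isNzRing.Build env
  env_mulA env_mul1 env_mulr1 env_mulDl env_mulDr env_1neq0.

Lemma env_piD u v : env_pi (uexp_add u v) = env_pi u + env_pi v.
Proof. by rewrite -env_addE. Qed.
Lemma env_piM u v : env_pi (uexp_mul u v) = env_pi u * env_pi v.
Proof. by rewrite -env_mulE. Qed.

Definition env_scale (a : K) (u : env) : env := env_scal a * u.

Fact env_scaleA a b u : env_scale a (env_scale b u) = env_scale (a * b) u.
Proof.
rewrite /env_scale mulrA; congr (_ * _); rewrite -env_piM.
by apply/env_piP/urel_sym/urel_scalM.
Qed.
Fact env_scale1 : left_id 1 env_scale. Proof. exact: mul1r. Qed.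
Fact env_scaleDr : right_distributive env_scale +%R.
Proof. by move=> a u v; exact: mulrDr. Qed.
Fact env_scaleDl u : {morph env_scale^~ u : a b / a + b}.
Proof.
move=> a b; rewrite /env_scale -mulrDl; congr (_ * _); rewrite -env_piD.
by apply/env_piP/urel_scalD.
Qed.
HB.instance Definition _ := GRing.Zmodule_isLmodule.Build K env
  env_scaleA env_scale1 env_scaleDr env_scaleDl.

Fact env_scaleAl a (u v : env) : a *: (u * v) = (a *: u) * v.
Proof. exact: mulrA. Qed.
HB.instance Definition _ := GRing.Lmodule_isLalgebra.Build K env env_scaleAl.

Fact env_scaleAr a (u v : env) : a *: (u * v) = u * (a *: v).
Proof.
rewrite [LHS]mulrA [RHS]mulrA; congr (_ * _).
elim/env_ind: u => u; rewrite -!env_piM.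
by apply/env_piP/urel_scalC.
Qed.
HB.instance Definition _ := GRing.Lalgebra_isAlgebra.Build K env env_scaleAr.

Definition env_gen (x : L) : env := env_pi (uexp_gen x).

Fact env_gen_linear : linear env_gen.
Proof.
move=> a x y; rewrite -[LHS]/(env_pi _).
have -> : env_pi (uexp_gen (a *: x + y))
          = env_pi (uexp_add (uexp_gen (a *: x)) (uexp_gen y)).
  by apply/env_piP/urel_genD.
rewrite env_piD; congr (_ + _).
have -> : env_pi (uexp_gen (a *: x))
          = env_pi (uexp_mul (uexp_scal a) (uexp_gen x)).
  by apply/env_piP/urel_genZ.
by rewrite env_piM.
Qed.
HB.instance Definition _ := GRing.isLinear.Build K L env _ env_gen
  env_gen_linear.

Lemma env_gen_lie x y :
  env_gen (lie x y) = env_gen x * env_gen y - env_gen y * env_gen x.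
Proof.
apply/esym/eqP; rewrite subr_eq addrC -env_piM; apply/eqP.
by rewrite -env_piM -env_piD; apply/env_piP/urel_lie.
Qed.

End Enveloping.

(* The induced module U(L) (x)_{U(b)} K_chi, where the subalgebra b of L acts *)
(* on K_chi = K through chi. As the ring U(b) is generated by K and b, it is  *)
(* enough to balance the tensor product over K and b.                         *)
Section Induced.
Variables (K : fieldType) (L : lieType K) (b : set L) (chi : L -> K).
Local Notation U := (env L).

Inductive texp : Type :=
| texp_pure of U & K
| texp_add of texp & texp.

Inductive trel : texp -> texp -> Prop :=
| trel_refl s : trel s s
| trel_sym s t : trel s t -> trel t s
| trel_trans s t w : trel s t -> trel t w -> trel s w
| trel_add s s' t t' : trel s s' -> trel t t' ->
    trel (texp_add s t) (texp_add s' t')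
| trel_addA s t w :
    trel (texp_add s (texp_add t w)) (texp_add (texp_add s t) w)
| trel_addC s t : trel (texp_add s t) (texp_add t s)
| trel_add0 a t : trel (texp_add (texp_pure 0 a) t) t
| trel_pureDl u v a :
    trel (texp_pure (u + v) a) (texp_add (texp_pure u a) (texp_pure v a))
| trel_pureDr u a a' :
    trel (texp_pure u (a + a')) (texp_add (texp_pure u a) (texp_pure u a'))
| trel_scal c u a : trel (texp_pure (c *: u) a) (texp_pure u (c * a))
| trel_bal u y a : b y ->
    trel (texp_pure (u * env_gen y) a) (texp_pure u (chi y * a)).

HB.instance Definition _ := gen_eqMixin texp.
HB.instance Definition _ := gen_choiceMixin texp.

Definition trelb (s t : texp) : bool := `[< trel s t >].

Fact trelb_refl : reflexive trelb.
Proof. by move=> s; apply/asboolP; exact: trel_refl. Qed.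
Fact trelb_sym : symmetric trelb.
Proof. by move=> s t; apply/asboolP/asboolP; exact: trel_sym. Qed.
Fact trelb_trans : transitive trelb.
Proof.
by move=> t s w /asboolP st /asboolP tw; apply/asboolP/(trel_trans st tw).
Qed.
Canonical trelb_equiv := EquivRel trelb trelb_refl trelb_sym trelb_trans.

Definition induced : Type := {eq_quot trelb}%qT.
HB.instance Definition _ := Choice.on induced.

Definition ind_pi (s : texp) : induced := \pi_({eq_quot trelb})%qT s.
Definition ind_repr (v : induced) : texp := repr (v : {eq_quot trelb}%qT).

Lemma ind_piK : cancel ind_repr ind_pi.
Proof. by move=> u; rewrite /ind_pi /ind_repr reprK. Qed.

Lemma ind_piP s t : ind_pi s = ind_pi t <-> trel s t.
Proof.
rewrite /ind_pi; split=> [/eqmodP/asboolP//|st].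
by apply/eqmodP/asboolP.
Qed.

Lemma ind_reprK s : trel (ind_repr (ind_pi s)) s.
Proof. by apply/ind_piP; rewrite ind_piK. Qed.

Lemma ind_ind (P : induced -> Prop) : (forall s, P (ind_pi s)) -> forall v, P v.
Proof. by move=> h u; rewrite -[u]ind_piK. Qed.

Fixpoint texp_act (u : U) (t : texp) : texp :=
  match t with
  | texp_pure v a => texp_pure (u * v) a
  | texp_add s t => texp_add (texp_act u s) (texp_act u t)
  end.

Lemma trel_act u s t : trel s t -> trel (texp_act u s) (texp_act u t).
Proof.
elim=> /=.
- by move=> ?; exact: trel_refl.
- by move=> ? ? _; exact: trel_sym.
- by move=> ? ? ? _ + _; exact: trel_trans.
- by move=> ? ? ? ? _ + _; exact: trel_add.
- by move=> *; exact: trel_addA.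
- by move=> *; exact: trel_addC.
- by move=> *; rewrite mulr0; exact: trel_add0.
- by move=> *; rewrite mulrDr; exact: trel_pureDl.
- by move=> *; exact: trel_pureDr.
- by move=> *; rewrite -scalerAr; exact: trel_scal.
- by move=> *; rewrite mulrA; exact: trel_bal.
Qed.

Definition ind_zero : induced := ind_pi (texp_pure 0 0).
Definition ind_add (v w : induced) : induced :=
  ind_pi (texp_add (ind_repr v) (ind_repr w)).
Definition ind_act (u : U) (v : induced) : induced :=
  ind_pi (texp_act u (ind_repr v)).

Lemma ind_addE s t : ind_add (ind_pi s) (ind_pi t) = ind_pi (texp_add s t).
Proof. by apply/ind_piP/trel_add; exact: ind_reprK. Qed.
Lemma ind_actE u t : ind_act u (ind_pi t) = ind_pi (texp_act u t).
Proof. by apply/ind_piP/trel_act; exact: ind_reprK. Qed.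

Fact ind_addA : associative ind_add.
Proof.
elim/ind_ind=> s; elim/ind_ind=> t; elim/ind_ind=> w; rewrite !ind_addE.
by apply/ind_piP/trel_addA.
Qed.
Fact ind_addC : commutative ind_add.
Proof.
elim/ind_ind=> s; elim/ind_ind=> t; rewrite !ind_addE.
by apply/ind_piP/trel_addC.
Qed.
Fact ind_add0 : left_id ind_zero ind_add.
Proof. by elim/ind_ind=> s; rewrite ind_addE; apply/ind_piP/trel_add0. Qed.

Lemma trel_addACA s t s' t' :
  trel (texp_add (texp_add s t) (texp_add s' t'))
       (texp_add (texp_add s s') (texp_add t t')).
Proof.
apply/ind_piP; rewrite -!ind_addE -!ind_addA; congr (ind_add _ _).
by rewrite !ind_addA (ind_addC (ind_pi t)).
Qed.

Lemma trel_pure0 a : trel (texp_pure 0 a) (texp_pure 0 0).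
Proof.
apply: (trel_trans (trel_sym (trel_add0 0 _))).
exact: (trel_trans (trel_addC _ _) (trel_add0 _ _)).
Qed.

Lemma trel_actDl u u' t :
  trel (texp_act (u + u') t) (texp_add (texp_act u t) (texp_act u' t)).
Proof.
elim: t => [v a|s IHs t IHt] /=; first by rewrite mulrDl; exact: trel_pureDl.
exact: (trel_trans (trel_add IHs IHt) (trel_addACA _ _ _ _)).
Qed.

Lemma texp_actM u u' t : texp_act (u * u') t = texp_act u (texp_act u' t).
Proof. by elim: t => [v a|s IHs t IHt] /=; rewrite ?mulrA ?IHs ?IHt. Qed.

Lemma texp_act1 t : texp_act 1 t = t.
Proof. by elim: t => [v a|s IHs t IHt] /=; rewrite ?mul1r ?IHs ?IHt. Qed.

Lemma trel_act0 t : trel (texp_act 0 t) (texp_pure 0 0).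
Proof.
elim: t => [v a|s IHs t IHt] /=; first by rewrite mul0r; exact: trel_pure0.
exact: (trel_trans (trel_add IHs IHt) (trel_add0 _ _)).
Qed.

Fact ind_addN : left_inverse ind_zero (ind_act (- 1)) ind_add.
Proof.
elim/ind_ind=> t; rewrite ind_actE ind_addE; apply/ind_piP.
rewrite -{2}[t]texp_act1; apply: (trel_trans (trel_sym (trel_actDl _ _ _))).
by rewrite addNr; exact: trel_act0.
Qed.
HB.instance Definition _ :=
  GRing.isZmodule.Build induced ind_addA ind_addC ind_add0 ind_addN.

Lemma ind_actDr u : {morph ind_act u : v w / v + w}.
Proof.
elim/ind_ind=> s; elim/ind_ind=> t.
change (ind_act u (ind_add (ind_pi s) (ind_pi t))
  = ind_add (ind_act u (ind_pi s)) (ind_act u (ind_pi t))).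
by rewrite !(ind_addE, ind_actE).
Qed.
Lemma ind_actDl v : {morph ind_act^~ v : u u' / u + u'}.
Proof.
elim/ind_ind: v => t u u'.
change (ind_act (u + u') (ind_pi t)
  = ind_add (ind_act u (ind_pi t)) (ind_act u' (ind_pi t))).
by rewrite !(ind_addE, ind_actE); apply/ind_piP/trel_actDl.
Qed.
Lemma ind_actM u u' v : ind_act (u * u') v = ind_act u (ind_act u' v).
Proof. by elim/ind_ind: v => t; rewrite !ind_actE texp_actM. Qed.
Lemma ind_act1 v : ind_act 1 v = v.
Proof. by elim/ind_ind: v => t; rewrite ind_actE texp_act1. Qed.

Definition ind_scale (a : K) (v : induced) := ind_act a%:A v.

Fact ind_scaleA a a' v :
  ind_scale a (ind_scale a' v) = ind_scale (a * a') v.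
Proof. by rewrite /ind_scale -ind_actM mulr_algl scalerA. Qed.
Fact ind_scale1 : left_id 1 ind_scale.
Proof. by move=> v; rewrite /ind_scale scale1r ind_act1. Qed.
Fact ind_scaleDr : right_distributive ind_scale +%R.
Proof. by move=> a v w; exact: ind_actDr. Qed.
Fact ind_scaleDl v : {morph ind_scale^~ v : a a' / a + a'}.
Proof. by move=> a a'; rewrite /ind_scale scalerDl ind_actDl. Qed.
HB.instance Definition _ := GRing.Zmodule_isLmodule.Build K induced
  ind_scaleA ind_scale1 ind_scaleDr ind_scaleDl.

Lemma ind_actZl a u v : ind_act (a *: u) v = a *: ind_act u v.
Proof. by rewrite -mulr_algl ind_actM. Qed.

Fact ind_act_linear u : linear (ind_act u).
Proof.
move=> a v w; rewrite ind_actDr; congr (_ + _).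
by rewrite -ind_actZl -[a *: u]mulr_algr ind_actM.
Qed.
HB.instance Definition _ u := GRing.isLinear.Build K induced induced _
  (ind_act u) (ind_act_linear u).

Definition ind_pure (u : U) (a : K) : induced := ind_pi (texp_pure u a).

Lemma ind_act_pure u u' a : ind_act u (ind_pure u' a) = ind_pure (u * u') a.
Proof. exact: ind_actE. Qed.

Lemma ind_pure_bal u y a : b y ->
  ind_pure (u * env_gen y) a = ind_pure u (chi y * a).
Proof. by move=> by_; apply/ind_piP/trel_bal. Qed.

End Induced.

Section VacuumModule.
Variables (K : fieldType) (L : lieType K) (B : invForm L).

(* x_n = t^n (x) x *)
Definition affine_mode (x : L) (n : int) : affine B := (loop_monom n x, 0).
Definition affine_c : affine B := (0, 1).

(* K[t] (x) L + K c *)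
Definition affine_nonneg : set (affine B) :=
  [set X : affine B | forall n : int, n < 0 -> X.1 n = 0].

(* K[t] (x) L acts by 0 and c by kappa *)
Definition vacuum_char (kappa : K) (X : affine B) : K := kappa * X.2.

Definition env_mode (x : L) (n : int) : env (affine B) :=
  env_gen (affine_mode x n).

Definition vacuum_module (kappa : K) : lmodType K :=
  induced affine_nonneg (vacuum_char kappa).

Lemma affine_lie_mode x y m n :
  lie (affine_mode x m) (affine_mode y n) = affine_mode (lie x y) (m + n)
    + (if m == - n then m%:~R * B x y else 0) *: affine_c.
Proof.
rewrite -[LHS]/(affine_lie _ _) /affine_lie /= loop_lie_monom.
rewrite loop_cocycle_monom; congr pair; rewrite /=.
  by rewrite scaler0 addr0.
by rewrite add0r [RHS]mulr1.
Qed.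

Definition vacuum (kappa : K) : vacuum_module kappa := ind_pure _ _ 1 1.

Lemma env_mode_vacuum kappa x n : 0 <= n ->
  ind_act (env_mode x n) (vacuum kappa) = 0.
Proof.
move=> n0; rewrite /vacuum ind_act_pure mulr1 -[env_mode x n]mul1r.
rewrite ind_pure_bal.
  rewrite /vacuum_char /= mulr0 mul0r; apply/ind_piP.
  have := trel_scal affine_nonneg (vacuum_char kappa) 0 1 1.
  by rewrite scale0r mul0r => h; apply: (trel_trans (trel_sym h)); exact: trel_pure0.
by move=> k k0; rewrite [LHS]loop_monomE; case: eqP k0 n0 => // ->; case: ltgtP.
Qed.

Lemma env_c_vacuum kappa :
  ind_act (env_gen affine_c) (vacuum kappa) = kappa *: vacuum kappa.
Proof.
rewrite /vacuum ind_act_pure mulr1 -[env_gen _]mul1r ind_pure_bal; last by [].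
rewrite /vacuum_char /= -[RHS]/(ind_act _ _) ind_act_pure !mulr1.
apply/ind_piP/trel_sym.
by have := trel_scal affine_nonneg (vacuum_char kappa) kappa 1 1; rewrite mulr1.
Qed.

Definition iota_mode (p : nat) (pmap : L -> L) (x : L) (n : int) :
    env (affine B) :=
  env_mode x n ^+ p - env_mode (pmap x) (n * p%:Z).

End VacuumModule.

(* binom(m, k) = m (m - 1) ... (m - k + 1) / k! for an integer m *)
Definition binz (m : int) (k : nat) : int :=
  match m with
  | Posz n => 'C(n, k)%:Z
  | Negz n => (-1) ^+ k * 'C(n + k, k)%:Z
  end.

(* A : fdist V stands for the formal distribution sum_k (A k) z^k.            *)
Definition fdist (V : Type) : Type := int -> V -> V.

Section FormalDistributions.
Variables (K : fieldType) (V : lmodType K).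
Implicit Types A B : fdist V.

(* sum_n (a n) z^(e n) *)
Definition fseries (a : int -> V -> V) (e : int -> int) : fdist V :=
  fun k v => \sum_(n \in [set n | e n = k]) a n v.

(* the divided power d_z^i / i! of the derivative *)
Definition fderiv (i : nat) A : fdist V :=
  fun k v => (binz (k + i%:Z) i)%:~R *: A (k + i%:Z) v.

Definition fone : fdist V := fun k v => if k == 0 then v else 0.

Definition fsub A B : fdist V := fun k v => A k v - B k v.

(* :A B: = A_+ B + B A_-, where A_+ collects the powers z^i with i >= 0.      *)
(* Applied to a vector, both sums are finite when A and B are fields.         *)
Definition nprod A B : fdist V :=
  fun k v => \sum_(i \in [set i : int | 0 <= i]) A i (B (k - i) v)
           + \sum_(i \in [set i : int | i < 0]) B (k - i) (A i v).

(* :A_1 A_2 ... A_s: = :A_1 :A_2 ... A_s:: *)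
Definition nprods (As : seq (fdist V)) : fdist V := foldr nprod fone As.

(* Y a k is the coefficient of z^k in Y(a, z), and a_(n) is that of z^(-n-1). *)
Definition vmode (Y : V -> fdist V) (a : V) (n : int) (b : V) : V :=
  Y a (- n - 1) b.

(* The Borcherds identity, in a form that makes sense in any characteristic;  *)
(* its sums are finite by va_field.                                           *)
Record is_vertex_algebra (vac : V) (Y : V -> fdist V) : Prop :=
  IsVertexAlgebra {
  va_linearl : forall k b, linear (fun a => Y a k b);
  va_linearr : forall a k, linear (Y a k);
  va_field : forall a b, exists N : int, forall k, k < N -> Y a k b = 0;
  va_vacuum : Y vac = fone;
  va_creation : forall a,
    Y a 0 vac = a /\ forall k : int, k < 0 -> Y a k vac = 0;
  va_borcherds : forall a b c (l m n : int),
    \sum_(i \in [set: nat]) (binz m i)%:~R *: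
      vmode Y (vmode Y a (l + i%:Z) b) (m + n - i%:Z) c
    = \sum_(i \in [set: nat]) ((-1) ^+ i * (binz l i)%:~R) *:
      (vmode Y a (l + m - i%:Z) (vmode Y b (n + i%:Z) c)
       - (-1) ^ l *: vmode Y b (l + n - i%:Z) (vmode Y a (m + i%:Z) c))
}.

End FormalDistributions.

Section VacuumVertexAlgebra.
Variables (K : fieldType) (L : lieType K) (B : invForm L) (kappa : K).
Local Notation V := (vacuum_module B kappa).
Local Notation vac := (vacuum B kappa).

(* x(z) = sum_n x_n z^(-n-1) *)
Definition current (x : L) : fdist V :=
  fseries (fun n => ind_act (env_mode B x n)) (fun n => - n - 1).

Definition current_deriv (x : L) (r : nat) : fdist V :=
  fderiv r.-1 (current x).

(* Y(x_{-r_1} y_{-r_2} ... vac, z) = :d^(r_1-1) x(z) d^(r_2-1) y(z) ...: *)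
Definition is_state_field (Y : V -> fdist V) :=
  forall s : seq (L * nat), all (fun xr => 0 < xr.2)%N s ->
    Y (ind_act (\prod_(xr <- s) env_mode B xr.1 (- xr.2%:Z)) vac)
    = nprods [seq current_deriv xr.1 xr.2 | xr <- s].

(* iota applied to d^(r-1) x(z) = sum_n binom(-n-1, r-1) x_n z^(-n-r) *)
Definition iota_current_deriv (p : nat) (pmap : L -> L) (x : L) (r : nat) :
    fdist V :=
  fseries (fun n v => (binz (- n - 1) r.-1)%:~R *:
                        ind_act (iota_mode B p pmap x n) v)
          (fun n => - n * p%:Z - r%:Z * p%:Z).

End VacuumVertexAlgebra.

Arguments current {K L} B kappa x _ _.
Arguments current_deriv {K L} B kappa x r _ _.
Arguments iota_current_deriv {K L} B kappa p pmap x r _ _.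

(* Main.v *)
(* Write [A = A_+ + A_-] for the field [d^(r-1) x(z)]. The modes occurring in   *)
(* [A_+] commute with one another, and so do those in [A_-], so that the normal *)
(* power [:A^p:], the sum of the [C(p, i) A_+^(p-i) A_-^i], is [A_+^p + A_-^p]  *)
(* in characteristic p, that is, the termwise p-th power of A by the Frobenius  *)
(* identity. The binomial coefficients of [d^(rp-1) x^[p](z)] are compared with *)
(* those of A by Lucas' congruence. Applied to a fixed vector, A has finitely   *)
(* many negative powers, say from [z^-N] on, and [z^N A] can be replaced by a   *)
(* polynomial over U(g).                                                        *)

Require Import Defs.
From mathcomp Require Import all_boot all_order all_algebra.
From mathcomp Require Import boolp classical_sets fsbigop.
From mathcomp Require Import zify.
Set Implicit Arguments.
Unset Strict Implicit.
Unset Printing Implicit Defensive.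
Import Order.TTheory GRing.Theory.
Local Open Scope ring_scope.

(** Only the last equality goes beyond the state-field rule and linearity. Normal ordering puts A_+
    on the left and A_- on the right, so :A^p: arises by iterating w |-> A_+ w + w A_-. Left and
    right multiplications commute even if A_+ and A_- do not, hence the binomial theorem gives A_+^p
    + A_-^p ([iter_mulDlr_pchar]). Inside each half the modes commute, so Frobenius removes the
    cross terms ([coef_exp_pchar]), and [nprods_nseq_pchar] finds at z^(qp) the p-th power of the
    mode of A at z^q. The binomials lie in the prime field, so they equal their p-th powers, and by
    [binz_mulp_pred] they are also the coefficients of the rp-1 derivative; the difference is iota
    of A, term by term. *)

(** * Binomial and Frobenius identities in noncommutative rings *)

Lemma iter_mulDlr (R : nzRingType) (x y : R) n :
  iter n (fun w => x * w + w * y) 1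
  = \sum_(i < n.+1) (x ^+ (n - i) * y ^+ i) *+ 'C(n, i).
Proof.
elim: n => [|n IHn]; first by rewrite big_ord1 mulr1.
rewrite iterS {}IHn mulr_suml mulr_sumr.
rewrite [in RHS]big_ord_recl [X in X + _ = _]big_ord_recl /= !bin0 !subn0 !mulr1 !mulr1n -exprS.
rewrite -addrA; congr (_ + _).
rewrite [in RHS]big_ord_recr [X in _ + X = _]big_ord_recr /= /bump !add1n !binn !subnn.
rewrite !mul1r !mulr1n -exprSr addrA; congr (_ + _).
rewrite -big_split; apply: eq_bigr => i _; rewrite /= ?add1n.
rewrite mulrnAr mulrnAl mulrA -exprS -subSn ?(valP i)// subSS -mulrA -exprSr.
by rewrite -mulrnDr binS.
Qed.

Lemma iter_mulDlr_pchar (R : nzRingType) p (x y : R) : p \in [pchar R] ->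
  iter p (fun w => x * w + w * y) 1 = x ^+ p + y ^+ p.
Proof.
move=> pR; have pr := pcharf_prime pR; rewrite iter_mulDlr.
case: p pR pr => // p pR pr.
rewrite big_ord_recl big_ord_recr /= bin0 binn subn0 subnn mulr1 mul1r.
rewrite big1 ?add0r// => i _; rewrite -mulr_natr.
suff /eqP-> : 'C(p.+1, bump 0 i)%:R == 0 :> R by rewrite mulr0.
by rewrite -(dvdn_pcharf pR) prime_dvd_bin// /bump add1n !ltnS /=.
Qed.

Lemma expr_sum_pchar (R : nzRingType) p (I : eqType) (s : seq I) (F : I -> R) :
  p \in [pchar R] -> (forall i j, GRing.comm (F i) (F j)) ->
  (\sum_(i <- s) F i) ^+ p = \sum_(i <- s) F i ^+ p.
Proof.
move=> pR FC; elim: s => [|i s IHs].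
  by rewrite !big_nil expr0n gtn_eqF// prime_gt0// (pcharf_prime pR).
rewrite !big_cons -!(pFrobenius_autE pR) pFrobenius_autD_comm; last first.
  by apply: commr_sum => j _; exact: FC.
by rewrite !pFrobenius_autE IHs.
Qed.

Lemma coef_exp_pchar (R : nzRingType) p (f : {poly R}) k :
  p \in [pchar R] -> (forall i j, GRing.comm f`_i f`_j) ->
  (f ^+ p)`_k = if (p %| k)%N then f`_(k %/ p)%N ^+ p else 0.
Proof.
move=> pR fC; have p0 := prime_gt0 (pcharf_prime pR).
have XnC (c : R) i : GRing.comm c%:P ('X^i : {poly R}).
  by rewrite /GRing.comm commr_polyXn.
rewrite -{1}[f]coefK poly_def expr_sum_pchar ?pchar_poly//; last first.
  move=> i j; rewrite -!mul_polyC.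
  apply: commrM; apply: commr_sym; apply: commrM; try exact: XnC.
  - by rewrite /GRing.comm -!polyCM fC.
  - exact/commr_sym/XnC.
  - by rewrite /GRing.comm -!exprD addnC.
rewrite coef_sum; under eq_bigr => i _.
  rewrite -mul_polyC exprMn_comm// -polyC_exp -exprM mul_polyC coefZ coefXn.
  over.
case: ifPn => [/dvdnP[q ->]|pk].
  rewrite mulnK//; have [qf|qf] := ltnP q (size f).
    rewrite (bigD1 (Ordinal qf))//= eqxx mulr1 big1 ?addr0// => i.
    rewrite -val_eqE eqn_pmul2r//= eq_sym => /negbTE->; exact: mulr0.
  rewrite nth_default// expr0n gtn_eqF// big1// => i _.
  by rewrite eqn_pmul2r// gtn_eqF ?mulr0// (leq_trans (ltn_ord i)).
rewrite big1// => i _; case: eqP pk => [->|]; last by rewrite mulr0.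
by rewrite dvdn_mull.
Qed.

(** * Binomial coefficients modulo p *)

Lemma coef_1DXn (R : nzRingType) n k : ((1 + 'X) ^+ n : {poly R})`_k = 'C(n, k)%:R.
Proof.
rewrite addrC exprD1n coef_sum; under eq_bigr => i _ do rewrite coefMn coefXn.
have [kn|kn] := ltnP k n.+1.
  rewrite (bigD1 (Ordinal kn))//= eqxx big1 ?addr0// => i.
  by rewrite -val_eqE eq_sym => /negbTE->; rewrite mul0rn.
rewrite bin_small// big1// => i _.
by rewrite gtn_eqF ?mul0rn// (leq_trans (ltn_ord i)).
Qed.

(** Lucas: in ((1 + X)^q)^p (1 + X)^u the first factor has only exponents divisible by p, and u <
    p. *)
Lemma bin_pchar (R : comNzRingType) p q s u t : p \in [pchar R] ->
  (u < p)%N -> (t < p)%N ->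
  'C(q * p + u, s * p + t)%:R = 'C(q, s)%:R * 'C(u, t)%:R :> R.
Proof.
move=> pR up tp; have p0 := prime_gt0 (pcharf_prime pR).
rewrite -coef_1DXn exprD exprM coefM.
under eq_bigr => i _.
  rewrite coef_exp_pchar//; last by move=> *; exact: mulrC.
  rewrite !coef_1DXn -(pFrobenius_autE pR) pFrobenius_aut_nat.
  over.
have sp : (s * p < (s * p + t).+1)%N by rewrite ltnS leq_addr.
rewrite (bigD1 (Ordinal sp))//= dvdn_mull// mulnK// addKn big1 ?addr0// => i.
rewrite -val_eqE /=; case: ifP => [/dvdnP[j ij]|_]; last by rewrite mul0r.
rewrite ij => js; rewrite ['C(u, _)]bin_small ?mulr0//.
have : (j * p < (s * p + t).+1)%N by rewrite -ij.
(* j > s contradicts t < p; j < s leaves the second factor an exponent of at least p > u. *)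
have : (j < s)%N \/ (s < j)%N by case: ltngtP js => //; [left|right|move=> ->; rewrite eqxx].
nia.
Qed.

(** The last base-p digit of (r+1)p - 1 is p - 1, so by Lucas the upper entry must end in p - 1 as
    well, which means p | n. *)
Lemma bin_mulp_pred (R : comNzRingType) p n r : p \in [pchar R] ->
  'C(n + (r.+1 * p)%N.-1, (r.+1 * p)%N.-1)%:R
  = (if (p %| n)%N then 'C(n %/ p + r, r)%:R else 0) :> R.
Proof.
move=> pR; have p0 := prime_gt0 (pcharf_prime pR).
have -> : (r.+1 * p)%N.-1 = (r * p + p.-1)%N by lia.
case: ifPn => [/dvdnP[q ->]|pn].
  rewrite mulnK// addnA -mulnDl bin_pchar ?prednK//.
  by rewrite binn mulr1.
(* Adding p - 1 to the nonzero last digit of n carries and leaves a digit below p - 1. *)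
have -> : (n + (r * p + p.-1) = (n %/ p + r).+1 * p + (n %% p).-1)%N.
  rewrite /dvdn -lt0n in pn.
  rewrite {1}(divn_eq n p) mulSn mulnDl.
  by move: (n %/ p)%N (n %% p)%N pn => a b; lia.
rewrite /dvdn -lt0n in pn; have := ltn_pmod n p0; move: (n %% p)%N pn => b b0 bp.
by rewrite bin_pchar ?prednK ?['C(b.-1, _)]bin_small ?mulr0//; lia.
Qed.

(** The exponents can differ in parity only for p = 2, where -1 = 1; Frobenius treats all p at
    once. *)
Lemma exprN1_mulp_pred (R : nzRingType) p r : p \in [pchar R] ->
  (-1) ^+ (r.+1 * p)%N.-1 = (-1) ^+ r :> R.
Proof.
move=> pR; have p0 := prime_gt0 (pcharf_prime pR).
have N1p : (-1) ^+ p = -1 :> R by rewrite -(pFrobenius_autE pR) pFrobenius_autN pFrobenius_aut1.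
have /(congr1 (fun y => y * -1)) : (-1) ^+ (r.+1 * p) = (-1) ^+ r.+1 :> R.
  by rewrite mulnC exprM N1p.
rewrite -[in LHS](@prednK (r.+1 * p)) ?muln_gt0// !exprSr.
by rewrite -!mulrA mulrNN !mulr1.
Qed.

Lemma binz_mulp_pred (R : comNzRingType) p (k : int) r : p \in [pchar R] ->
  (binz (k + (r.+1 * p)%N.-1%:Z) (r.+1 * p)%N.-1)%:~R
  = (if (p%:Z %| k)%Z then (binz ((k %/ p)%Z + r%:Z) r)%:~R else 0) :> R.
Proof.
move=> pR; have p0 := prime_gt0 (pcharf_prime pR).
have pz : p%:Z != 0 by lia.
have [k0|k_lt0] := leP 0 k.
  case: k k0 => // n _; rewrite -PoszD [binz _ _]/= -pmulrn bin_mulp_pred//.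
  rewrite dvdzE /=; case: ifP => // _.
  by rewrite divz_nat -PoszD [binz _ _]/= -pmulrn.
(* In the first case the upper entry is a natural number smaller than the lower one, and both sides
   vanish. *)
have [k_ge|k_lt] := leP 0 (k + (r.+1 * p)%N.-1%:Z).
  have [n kn] : exists n : nat, k + (r.+1 * p)%N.-1%:Z = n.
    by exists (absz (k + (r.+1 * p)%N.-1%:Z)); lia.
  rewrite kn [binz _ _]/= bin_small; last lia.
  case: ifP => // /dvdzP[q kq]; rewrite kq mulzK//.
  have [m qm] : exists m : nat, q + r%:Z = m by exists (absz (q + r%:Z)); nia.
  by rewrite qm [binz _ _]/= bin_small//; nia.
have [n kn] : exists n : nat, k + (r.+1 * p)%N.-1%:Z = Negz n.
  by exists (absz (k + (r.+1 * p)%N.-1%:Z)).-1; lia.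
have -> : (p%:Z %| k)%Z = (p %| n)%N.
  have -> : k = - (n%:Z + (r.+1 * p)%N%:Z) by lia.
  by rewrite dvdzE abszN -PoszD /= dvdn_addl// dvdn_mull.
rewrite kn [binz _ _]/= rmorphM rmorphXn rmorphN1/= -pmulrn.
rewrite bin_mulp_pred// exprN1_mulp_pred//.
case: ifPn => [/dvdnP[q nq]|_]; last by rewrite mulr0.
have -> : k = - (q%:Z + r.+1%:Z) * p%:Z by nia.
have -> : (- (q%:Z + r.+1%:Z) * p%:Z %/ p%:Z)%Z + r%:Z = Negz q.
  by rewrite mulzK//; lia.
by rewrite [binz _ _]/= rmorphM rmorphXn rmorphN1/= -pmulrn nq mulnK.
Qed.

(** * Normally ordered powers of a field *)

Lemma fsum_shift (V : nmodType) (E : set int) (N n : nat) (f : int -> V) :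
  (forall i, E i -> (i < - N%:Z) || (n%:Z - N%:Z <= i) -> f i = 0) ->
  \sum_(i \in E) f i = \sum_(i < n | (i%:Z - N%:Z) \in E) f (i%:Z - N%:Z).
Proof.
move=> f0; pose r := [seq i%:Z - N%:Z | i <- iota 0 n].
have ur : uniq r by rewrite map_inj_uniq ?iota_uniq// => i j; lia.
rewrite (fsbigE [seq i <- r | i \in E]) ?filter_uniq//.
- rewrite big_filter_cond big_map -val_enum_ord big_map big_enum_cond/=.
  by apply: eq_bigl => i; rewrite andbb.
- by move=> i /=; rewrite mem_filter => /andP[/set_mem].
move=> i Ei; rewrite mem_filter (mem_set Ei)/= => ir; apply: f0 => //.
apply: contraNT ir => iN; apply/mapP; exists (absz (i + N%:Z)); last lia.
by rewrite mem_iota; lia.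
Qed.

Section NormalPowers.
Variables (K : fieldType) (L : lieType K) (b : set L) (chi : L -> K).
Local Notation V := (induced b chi).
Variable a : int -> env L.
Local Notation A := ((fun k v => ind_act (a k) v) : fdist V).

Lemma ind_act0l (v : V) : ind_act 0 v = 0.
Proof. by apply: (addrI (ind_act 0 v)); rewrite -ind_actDl !addr0. Qed.

Lemma ind_act_suml I (s : seq I) (P : pred I) (F : I -> env L) (v : V) :
  ind_act (\sum_(i <- s | P i) F i) v = \sum_(i <- s | P i) ind_act (F i) v.
Proof.
apply: (big_morph (fun u => ind_act u v)); [exact: ind_actDl|exact: ind_act0l].
Qed.

Lemma nprods_nseq0 j k : nprods (nseq j A) k 0 = 0.
Proof.
elim: j k => [|j IHj] k /=; first by rewrite /fone; case: ifP.
rewrite /nprod !fsbig1 ?addr0// => i _; first by rewrite linear0 IHj.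
by rewrite IHj linear0.
Qed.

Hypothesis a_neg_comm : forall i k, i < 0 -> k < 0 -> GRing.comm (a i) (a k).

Variable N : nat.

(** Each factor adds a pole of order at most N: since negative modes commute, [a i] applied to v,
    for i < 0, is still killed by the modes below -N. *)
Lemma nprods_nseq_lt j k (v : V) :
  (forall i, i < - N%:Z -> ind_act (a i) v = 0) ->
  k < - (j * N)%:Z -> nprods (nseq j A) k v = 0.
Proof.
elim: j k v => [|j IHj] k v v0 kN /=; first by rewrite /fone; case: eqP => //; lia.
rewrite /nprod !fsbig1 ?addr0// => i /= i0.
  have [iN|iN] := ltP i (- N%:Z); first by rewrite v0// nprods_nseq0.
  apply: IHj; last nia.
  by move=> l lN; rewrite -ind_actM a_neg_comm ?ind_actM ?v0 ?linear0//; lia.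
by rewrite IHj ?linear0//; nia.
Qed.

Variable D : nat.

(* [z^N A_+], truncated below degree D, and [z^N A_-] *)
Let P : {poly env L} :=
  \poly_(i < D) (if (i < N)%N then 0 else a (i%:Z - N%:Z)).
Let Q : {poly env L} := \poly_(i < N) a (i%:Z - N%:Z).

(** Multiplying every factor by z^N turns [nprod] with A into w |-> P w + w Q and shifts exponents
    by jN. Degrees s < D do not see the truncation of P. *)
Lemma nprods_nseq_poly j s (v : V) :
  (forall i, i < - N%:Z -> ind_act (a i) v = 0) -> (s < D)%N ->
  nprods (nseq j A) (s%:Z - (j * N)%:Z) v
  = ind_act (iter j (fun w => P * w + w * Q) 1)`_s v.
Proof.
elim: j s v => [|j IHj] s v v0 sD /=.
  rewrite /fone subr0 coef1 eqz_nat; case: eqP => _; first by rewrite ind_act1.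
  by rewrite ind_act0l.
have v0' i : i < 0 -> forall l, l < - N%:Z -> ind_act (a l) (ind_act (a i) v) = 0.
  by move=> i0 l lN; rewrite -ind_actM a_neg_comm ?ind_actM ?v0 ?linear0//; lia.
rewrite coefD ind_actDl coefM coefMr !ind_act_suml /nprod; congr (_ + _).
  rewrite (@fsum_shift _ _ N s.+1) => [|i /= i0 iN]; last first.
    by rewrite nprods_nseq_lt ?linear0//; lia.
  rewrite big_mkcond; apply: eq_bigr => -[i /= is_] _.
  rewrite coef_poly (leq_ltn_trans _ sD)// ind_actM.
  have -> : (i%:Z - N%:Z \in [set i : int | 0 <= i]%classic) = (N <= i)%N.
    by apply/idP/idP; rewrite inE /=; lia.
  case: leqP => _; last by rewrite ind_act0l.
  by rewrite -IHj//; [congr (ind_act _ (nprods _ _ _)); nia|lia].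
rewrite (@fsum_shift _ _ N s.+1) => [|i /= i0 /orP[iN|iN]]; last first.
- by rewrite nprods_nseq_lt//; [exact: v0'|nia].
- by rewrite v0// nprods_nseq0.
rewrite big_mkcond; apply: eq_bigr => -[i /= is_] _.
rewrite coef_poly ind_actM.
have -> : (i%:Z - N%:Z \in [set i : int | i < 0]%classic) = (i < N)%N.
  by apply/idP/idP; rewrite inE /=; lia.
case: ltnP => iN; last by rewrite ind_act0l linear0.
rewrite -IHj; [|by apply: v0'; lia|lia].
by congr (nprods _ _ _); nia.
Qed.

End NormalPowers.

Lemma nprods_nseq_pchar (K : fieldType) (L : lieType K) (b : set L)
    (chi : L -> K) (a : int -> env L) p N k (v : induced b chi) :
  p \in [pchar K] ->
  (forall i l, 0 <= i -> 0 <= l -> GRing.comm (a i) (a l)) ->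
  (forall i l, i < 0 -> l < 0 -> GRing.comm (a i) (a l)) ->
  (forall i, i < - N%:Z -> ind_act (a i) v = 0) ->
  nprods (nseq p (fun k v => ind_act (a k) v)) k v
  = if (p%:Z %| k)%Z then ind_act (a (k %/ p)%Z ^+ p) v else 0.
Proof.
move=> pK a_pos a_neg v0; have p0 := prime_gt0 (pcharf_prime pK).
have [kN|kN] := ltP k (- (p * N)%:Z).
  (* If k = qp then q < -N, so [a q] kills v and the right side is 0 too. *)
  rewrite (nprods_nseq_lt a_neg v0 kN); case: ifP => // /dvdzP[q kq].
  rewrite kq mulzK; last lia.
  by rewrite -[p in RHS]prednK// exprSr ind_actM v0 ?linear0//; nia.
have [s ks] : exists s : nat, k = s%:Z - (p * N)%:Z.
  by exists (absz (k + (p * N)%:Z)); lia.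
have pR : p \in [pchar env L] by rewrite pchar_lalg.
rewrite ks (@nprods_nseq_poly _ _ _ _ _ a_neg _ s.+1)//.
rewrite iter_mulDlr_pchar ?pchar_poly// coefD !coef_exp_pchar//; first last.
- move=> i j; rewrite !coef_poly.
  by do 4 ?[case: ifP => ?]; rewrite /GRing.comm ?mul0r ?mulr0//; apply: a_pos; lia.
- move=> i j; rewrite !coef_poly.
  by do 2 ?[case: ifP => ?]; rewrite /GRing.comm ?mul0r ?mulr0//; apply: a_neg; lia.
have -> : (p%:Z %| (s%:Z - (p * N)%:Z))%Z = (p %| s)%N.
  by rewrite rpredBr// dvdzE dvdn_mulr.
case: ifP => [/dvdnP[q sq]|_]; last by rewrite addr0 ind_act0l.
rewrite sq mulnK// !coef_poly.
have -> : (((q * p)%N%:Z - (p * N)%:Z) %/ p%:Z)%Z = q%:Z - N%:Z.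
  have -> : (q * p)%N%:Z - (p * N)%:Z = (q%:Z - N%:Z) * p%:Z by nia.
  by rewrite mulzK//; lia.
have -> : (q < (q * p).+1)%N by nia.
(* P and Q have disjoint supports: one of the two coefficients is the mode, the other is 0. *)
by case: ifP => _; rewrite expr0n gtn_eqF// ?addr0 ?add0r.
Qed.

(** * Modes of the derivatives of a current *)

Lemma comm_env_mode (K : fieldType) (L : lieType K) (B : invForm L) x m n :
  (m == - n) && (m != 0) = false ->
  GRing.comm (env_mode B x m) (env_mode B x n).
Proof.
move=> mn; apply/eqP; rewrite -subr_eq0 -env_gen_lie affine_lie_mode liexx.
have -> : affine_mode B (0 : L) (m + n) = 0.
  by congr pair; apply: loopP => i; rewrite loop_monomE; case: ifP.
case: eqP mn => [_ /negbFE/eqP->|_ _]; first by rewrite mul0r scale0r addr0 linear0.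
by rewrite scale0r addr0 linear0.
Qed.

Lemma fseries_unique (K : fieldType) (V : lmodType K) (a : int -> V -> V) e n k v :
  (forall i, e i = k <-> i = n) -> fseries a e k v = a n v.
Proof.
move=> en; rewrite /fseries (_ : [set i | e i = k]%classic = [set n]%classic).
  by rewrite fsbig_set1.
by apply/seteqP; split=> i /= /en.
Qed.

(** The coefficient of z^k, coming from n = -k - r, for which -n - 1 = k + r - 1. *)
Definition current_deriv_mode (K : fieldType) (L : lieType K) (B : invForm L)
    (x : L) (r : nat) (k : int) : env (affine B) :=
  (binz (k + r.-1%:Z) r.-1)%:~R *: env_mode B x (- k - r%:Z).

(** x_m and x_n can fail to commute only if m = -n is nonzero. Exponents k >= 0 give indices -k - r
    < 0, exponents k <= -r give indices >= 0, and in the gap between them the binomial vanishes. *)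
Lemma comm_current_deriv_mode (K : fieldType) (L : lieType K) (B : invForm L)
    x r i j :
  (0 < r)%N -> (0 <= i) = (0 <= j) ->
  GRing.comm (current_deriv_mode B x r i) (current_deriv_mode B x r j).
Proof.
move=> r0 ij; rewrite /current_deriv_mode.
have binz0 k : k < 0 -> - r%:Z < k -> binz (k + r.-1%:Z) r.-1 = 0.
  move=> k0 kr; have [n kn] : exists n : nat, k + r.-1%:Z = n.
    by exists (absz (k + r.-1%:Z)); lia.
  by rewrite kn [LHS]/= bin_small//; lia.
rewrite /GRing.comm -!scalerAl -!scalerAr !scalerA mulrC.
have [i_mid|i_out] := boolP ((i < 0) && (- r%:Z < i)).
  by rewrite (binz0 i) ?mulr0 ?scale0r//; lia.
have [j_mid|j_out] := boolP ((j < 0) && (- r%:Z < j)).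
  by rewrite (binz0 j) ?mul0r ?scale0r//; lia.
by rewrite comm_env_mode//; lia.
Qed.

Lemma current_derivE (K : fieldType) (L : lieType K) (B : invForm L) kappa x r :
  (0 < r)%N -> current_deriv B kappa x r
  = fun k => ind_act (current_deriv_mode B x r k).
Proof.
move=> r0; apply/funext => k; apply/funext => v.
rewrite /current_deriv /fderiv /current (@fseries_unique _ _ _ _ (- k - r%:Z)).
  by rewrite ind_actZl.
by move=> i; split; lia.
Qed.

(** Coefficients of an [fdist] are arbitrary maps, so their vanishing at 0 has to be assumed. *)
Lemma nprods1 (K : fieldType) (V : lmodType K) (A : fdist V) :
  (forall k, A k 0 = 0) -> nprods [:: A] = A.
Proof.
move=> A0; apply/funext => k; apply/funext => v; rewrite /= /nprod.
have fone0 i w : i != k -> fone (k - i) w = 0 :> V.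
  by rewrite /fone subr_eq0 eq_sym => /negbTE->.
have fone1 w : fone (k - k) w = w :> V by rewrite /fone subrr eqxx.
have [k0|k0] := leP 0 k.
  rewrite -(fsbig_widen [set k]%classic) ?fsbig_set1 ?fone1; first last.
  - by move=> i [_ /= /eqP ik]; rewrite fone0 ?A0.
  - by move=> i /= ->.
  by rewrite fsbig1 ?addr0// => i /= i0; rewrite fone0//; apply/eqP; lia.
rewrite fsbig1 ?add0r => [|i /= i0]; last first.
  by rewrite fone0 ?A0//; apply/eqP; lia.
rewrite -(fsbig_widen [set k]%classic) ?fsbig_set1 ?fone1//.
- by move=> i /= ->.
- by move=> i [_ /= /eqP ik]; rewrite fone0.
Qed.

Theorem proposition2p6 (p : nat) (K : closedFieldType) (charK : p \in [pchar K])
    (L : finDimLieType K) (pmap : L -> L) (B : invForm L)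
    (L_semisimple : semisimple_lie L)
    (L_simply_connected : lie_of_simply_connected p pmap)
    (B_nondegenerate : nondegenerate_form B)
    (kappa : K)
    (Y : vacuum_module B kappa -> fdist (vacuum_module B kappa))
    (Y_vertex : is_vertex_algebra (vacuum B kappa) Y)
    (Y_state_field : is_state_field Y)
    (x : L) (r : nat) (r_ge1 : (1 <= r)%N) :
  [/\ Y (ind_act (iota_mode B p pmap x (- r%:Z)) (vacuum B kappa))
      = Y (ind_act (env_mode B x (- r%:Z) ^+ p
                    - env_mode B (pmap x) (- (r * p)%N%:Z)) (vacuum B kappa)),
      Y (ind_act (env_mode B x (- r%:Z) ^+ p
                  - env_mode B (pmap x) (- (r * p)%N%:Z)) (vacuum B kappa))
      = fsub (nprods (nseq p (current_deriv B kappa x r)))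
             (current_deriv B kappa (pmap x) (r * p)) &
      fsub (nprods (nseq p (current_deriv B kappa x r)))
           (current_deriv B kappa (pmap x) (r * p))
      = iota_current_deriv B kappa p pmap x r].
Proof.
have p0 := prime_gt0 (pcharf_prime charK).
have Y_current y s : (0 < s)%N ->
    Y (ind_act (env_mode B y (- s%:Z)) (vacuum B kappa)) = current_deriv B kappa y s.
  move=> s0; have := Y_state_field [:: (y, s)]; rewrite big_seq1 => ->; last first.
    by rewrite /= s0.
  by rewrite nprods1// current_derivE// => k; rewrite linear0.
split.
- by rewrite /iota_mode mulNr -PoszM.
- apply/funext => k; apply/funext => v; rewrite /fsub -(Y_current (pmap x)) ?muln_gt0 ?r_ge1//.
  have := Y_state_field (nseq p (x, r)).
  rewrite all_nseq r_ge1 orbT map_nseq /= big_nseq => /(_ isT) <-.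
  have -> (u : env (affine B)) n : iter n ( *%R u) 1 = u ^+ n.
    by elim: n => // n IHn; rewrite exprS -IHn.
  rewrite ind_actDl -scaleN1r ind_actZl addrC.
  by rewrite (va_linearl Y_vertex) scaleN1r addrC.
apply/funext => k; apply/funext => v.
rewrite /fsub !current_derivE ?muln_gt0 ?r_ge1//.
(* The field axiom for the state x_{-r} applied to the vacuum bounds the pole at v. *)
have [N vN] : exists N : nat, forall i, i < - N%:Z ->
    ind_act (current_deriv_mode B x r i) v = 0.
  have [M vM] := va_field Y_vertex (ind_act (env_mode B x (- r%:Z)) (vacuum B kappa)) v.
  exists (absz M) => i iM; have := vM i; rewrite Y_current// current_derivE//.
  by apply; lia.
rewrite (nprods_nseq_pchar _ charK _ _ vN); first last.
- by move=> i l i0 l0; apply: comm_current_deriv_mode => //; lia.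
- by move=> i l i0 l0; apply: comm_current_deriv_mode => //; lia.
rewrite /current_deriv_mode -(prednK r_ge1) binz_mulp_pred//= prednK//.
rewrite /iota_current_deriv.
(* If p does not divide k, no term on either side has exponent k. *)
case: ifPn => [/dvdzP[q ->]|pk]; last first.
  rewrite scale0r ind_act0l subrr /fseries fsbig1// => n /= nk; case/negP: pk.
  by apply/dvdzP; exists (- n - r%:Z); lia.
rewrite mulzK; last lia.
rewrite (@fseries_unique _ _ _ _ (- q - r%:Z)); last by move=> i; split; nia.
(* Frobenius fixes the image of an integer, so both terms carry the same binomial factor. *)
rewrite exprZn -(pFrobenius_autE charK) pFrobenius_aut_int !ind_actZl -scalerBr.
rewrite /iota_mode ind_actDl -[- env_mode _ _ _]scaleN1r ind_actZl scaleN1r.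
have -> : - (- q - r%:Z) - 1 = q + r.-1%:Z by lia.
by have -> : - (q * p%:Z) - (r * p)%N%:Z = (- q - r%:Z) * p%:Z by lia.
Qed.
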